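(* Let $\bar d=(d_j)_{j\ge 0}$ be integers with $d_0=1$ and $d_j\ge 2$ for $j\ge 1$, and let $\bar p=(p_j)_{j\ge 1}$ with $p_j\in(0,1]$. Then $\sigma_p(c,\bar d,\bar p)=\sigma_p(c_0,\bar d,\bar p)\cup\{1\}$. In particular, $\sigma_p(c,\bar d,\bar p)=\{1\}$ if and only if $(p_n)_{n\ge1}$ does not converge to $1$.
   Context: $\mathbb{Z}_+=\{0,1,2,\dots\}$. Put $q_j=d_0d_1\cdots d_j$ for $j\ge 0$. Every $n\in\mathbb{Z}_+$ has a unique expansion $n=\sum_{j\ge1}a_j(n)q_{j-1}$ with digits $a_j(n)\in\{0,\dots,d_j-1\}$, only finitely many nonzero. Put $\zeta_n=\min\{j\ge1: a_j(n)\ne d_j-1\}$. Let $S=[s(n,m)]_{n,m\ge0}$ be the stochastic matrix with entries: $s(n,n+1)=\prod_{j=1}^{\zeta_n}p_j$; $s(n,n)=1-p_1$; if $\zeta_n\ge2$, for $1\le r\le\zeta_n-1$, $s\big(n,\,n-\sum_{j=1}^r(d_j-1)q_{j-1}\big)=(1-p_{r+1})\prod_{j=1}^rp_j$; and $s(n,m)=0$ otherwise. $(Sw)(n)=\sum_m s(n,m)w(m)$ defines a bounded linear operator on each of the complex sequence spaces (indexed by $\mathbb{Z}_+$) $c$ (convergent sequences, sup norm) and $c_0$ (sequences tending to $0$, sup norm). $\sigma_p(\Omega,\bar d,\bar p)$ denotes the point spectrum (set of eigenvalues) of $S$ acting on $\Omega\in\{c,c_0\}$. *)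

(* Defs.v *)
From HB Require Import structures.
From mathcomp Require Import all_boot all_order all_algebra complex.
From mathcomp Require Import all_classical all_reals all_analysis.
Set Implicit Arguments.
Unset Strict Implicit.
Unset Printing Implicit Defensive.
Import Order.TTheory GRing.Theory Num.Theory.
Import numFieldNormedType.Exports.
Local Open Scope classical_set_scope.
Local Open Scope ring_scope.
Local Open Scope complex_scope.

(* Naming the structure makes the convergence notations for sequences of
   complex numbers find the topology given by the modulus. *)
Definition complexes (R : realType) : numClosedFieldType := R[i].

(* [d], [digit d] and [p] keep the 1-based indices of the digits; the values
   [digit d 0 n] and [p 0%N] are never used. *)
Definition place (d : nat -> nat) (j : nat) : nat :=
  (\prod_(0 <= i < j.+1) d i)%N.

(* The base-[d] digits; see [digit_sum] and [digit_uniq]. *)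
Definition digit (d : nat -> nat) (j n : nat) : nat :=
  ((n %/ place d j.-1) %% d j)%N.

(* The least j >= 1 whose digit is not d_j - 1. Looking at 1 <= j <= n + 1 is
   enough, since the digit of index n + 1 is 0; see [carry_index_least]. *)
Definition carry_index (d : nat -> nat) (n : nat) : nat :=
  (find (fun j => digit d j n != (d j).-1) (iota 1 n.+1)).+1.

(* In the last case distinct r have distinct targets, so that the sum
   over r has at most one term; see [transition_reset]. *)
Definition transition (R : realType) (d : nat -> nat) (p : nat -> R)
    (n m : nat) : R :=
  if m == n.+1 then \prod_(1 <= j < (carry_index d n).+1) p j
  else if m == n then 1 - p 1%N
  else \sum_(1 <= r < carry_index d n
             | m == (n - \sum_(1 <= j < r.+1) (d j).-1 * place d j.-1)%N)
         (1 - p r.+1) * \prod_(1 <= j < r.+1) p j.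

(* The series has finitely many nonzero terms; see [operatorE]. *)
Definition operator (R : realType) (d : nat -> nat) (p : nat -> R)
    (w : nat -> complexes R) : nat -> complexes R :=
  fun n => limn (series (fun m => (transition d p n m)%:C * w m : complexes R)).

Definition space_c (R : realType) : set (nat -> complexes R) :=
  [set w | cvgn w].

Definition space_c0 (R : realType) : set (nat -> complexes R) :=
  [set w | w @ \oo --> (0 : complexes R)].

Definition point_spectrum (R : realType) (Omega : set (nat -> complexes R))
    (d : nat -> nat) (p : nat -> R) : set (complexes R) :=
  [set lambda | exists w : nat -> complexes R,
     [/\ Omega w, w <> (fun=> 0)
       & forall n, operator d p w n = lambda * w n]].

Section Checks.
Variable d : nat -> nat.
Hypothesis d0 : d 0%N = 1%N.
Hypothesis d_ge2 : forall j, (1 <= j)%N -> (2 <= d j)%N.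

Lemma place0 : place d 0 = 1%N.
Proof. by rewrite /place big_nat1. Qed.

Lemma placeS j : place d j.+1 = (place d j * d j.+1)%N.
Proof. by rewrite /place big_nat_recr. Qed.

Lemma place_gt j : (j < place d j)%N.
Proof.
elim: j => [|j IH]; first by rewrite place0.
rewrite placeS; apply: (@leq_trans (place d j * 2)%N).
  by rewrite muln2 -addnn -addn1; apply: leq_add; rewrite // (leq_trans _ IH).
by rewrite leq_pmul2l ?d_ge2 // (leq_trans _ IH).
Qed.

Lemma digit_lt j n : (1 <= j)%N -> (digit d j n < d j)%N.
Proof. by move=> j1; rewrite ltn_mod (leq_trans _ (d_ge2 j1)). Qed.

Lemma digit_eq0 j n : (n < place d j.-1)%N -> digit d j n = 0%N.
Proof. by move=> nj; rewrite /digit divn_small // mod0n. Qed.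

Lemma digit_sum n J : (n < place d J)%N ->
  n = (\sum_(1 <= j < J.+1) digit d j n * place d j.-1)%N.
Proof.
move=> nJ; rewrite -{1}(modn_small nJ) {nJ}; elim: J => [|J IH].
  by rewrite place0 modn1 big_geq.
rewrite big_nat_recr //= -IH placeS /digit /= modn_divl addnC mulnC.
rewrite mulnC {1}(divn_eq (n %% (place d J * d J.+1)) (place d J)).
by congr (_ + _)%N; rewrite modn_dvdm // dvdn_mulr.
Qed.

Lemma digit_uniq (a : nat -> nat) J :
  (forall j, (1 <= j)%N -> (a j < d j)%N) ->
  (forall j, (J < j)%N -> a j = 0%N) ->
  forall j, (1 <= j)%N ->
    a j = digit d j (\sum_(1 <= i < J.+1) a i * place d i.-1)%N.
Proof.
move=> a_lt a0.
have lt_sum K : (\sum_(1 <= i < K.+1) a i * place d i.-1 < place d K)%N.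
  elim: K => [|K IH]; first by rewrite big_geq ?place0.
  rewrite big_nat_recr //= placeS.
  apply: (@leq_trans ((a K.+1).+1 * place d K)%N).
    by rewrite mulSn ltn_add2r.
  by rewrite mulnC leq_mul2l a_lt ?orbT.
have tail K : (J <= K)%N -> (\sum_(1 <= i < J.+1) a i * place d i.-1 =
    \sum_(1 <= i < K.+1) a i * place d i.-1)%N.
  move=> JK; rewrite [RHS](big_cat_nat _ (n := J.+1)) //=.
  rewrite [X in (_ + X)%N]big_nat_cond [X in (_ + X)%N]big1 ?addn0 // => i.
  by rewrite andbT => /andP[Ji _]; rewrite a0.
have dig K j : (1 <= j <= K)%N ->
    digit d j (\sum_(1 <= i < K.+1) a i * place d i.-1)%N = a j.
  elim: K => [|K IH] /andP[j1 jK]; first by case: j j1 jK.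
  have place_gt0 i : (0 < place d i)%N by apply: leq_ltn_trans (place_gt i).
  move: jK; rewrite leq_eqVlt big_nat_recr //= => /predU1P[-> /=|jK].
    by rewrite /digit /= addnC divnMDl // (divn_small (lt_sum _)) addn0
      modn_small ?a_lt.
  rewrite -[RHS]IH ?j1 // /digit addnC.
  have /dvdnP[q ->] : (place d j.-1 * d j %| place d K)%N.
    have -> : (place d j.-1 * d j = place d j)%N by case: (j) j1 => // i _; rewrite placeS.
    rewrite /place [in X in (_ %| X)%N](big_cat_nat _ (n := j.+1)) //=.
    exact: dvdn_mulr.
  by rewrite mulnA [(_ * (_ * d j))%N]mulnCA -mulnA mulnC divnMDl // mulnA modnMDl.
move=> j j1; rewrite (tail (maxn J j)) ?leq_maxl // dig //.
by rewrite j1 leq_maxr.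
Qed.

Lemma carry_index_least n :
  [/\ (1 <= carry_index d n)%N,
      digit d (carry_index d n) n <> (d (carry_index d n)).-1
    & forall j, (1 <= j < carry_index d n)%N -> digit d j n = (d j).-1].
Proof.
pose P j := digit d j n != (d j).-1.
have hasP : has P (iota 1 n.+1).
  apply/hasP; exists n.+1; first by rewrite mem_iota /= add1n ltnS leqnn.
  by rewrite /P digit_eq0 ?place_gt //; have := d_ge2 (ltn0Sn n); case: (d n.+1) => [|[]].
split=> //.
  have := nth_find 0%N hasP; rewrite /P nth_iota ?add1n; first by move/eqP.
  by move: hasP; rewrite has_find size_iota.
move=> j /andP[j1 jz]; have jz' : (j.-1 < find P (iota 1 n.+1))%N by case: j j1 jz.
have := before_find 0%N jz'; rewrite nth_iota ?add1n ?prednK //; last first.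
  rewrite -(prednK j1); apply: leq_trans jz' _.
  by rewrite -[leqRHS](size_iota 1) find_size.
by move/negbFE/eqP.
Qed.

Lemma reset_le n r : (r < carry_index d n)%N ->
  (\sum_(1 <= j < r.+1) (d j).-1 * place d j.-1 <= n)%N.
Proof.
move=> rz; have [_ _ full] := carry_index_least n.
have nJ : (n < place d (maxn r n))%N.
  by apply: leq_ltn_trans (place_gt _); rewrite leq_maxr.
have rJ : (r.+1 <= (maxn r n).+1)%N by rewrite ltnS leq_maxl.
rewrite [leqRHS](digit_sum nJ) (big_cat_nat _ rJ) //=.
apply: leq_trans (leq_addr _ _); apply: eq_leq.
apply: eq_big_nat => j /andP[j1 jr]; rewrite full // j1.
by apply: leq_trans rz.
Qed.

Lemma transition_reset (R : realType) (p : nat -> R) n r :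
  (1 <= r < carry_index d n)%N ->
  transition d p n (n - \sum_(1 <= j < r.+1) (d j).-1 * place d j.-1)%N =
    (1 - p r.+1) * \prod_(1 <= j < r.+1) p j.
Proof.
pose t r := (\sum_(1 <= j < r.+1) (d j).-1 * place d j.-1)%N.
move=> /andP[r1 rz]; rewrite -/(t r) /transition.
have t_lt : {homo t : a b / (a < b)%N}.
  apply: homo_ltn => [b a c|a]; first exact: ltn_trans.
  rewrite /t [ltnRHS]big_nat_recr //= -[ltnLHS]addn0 ltn_add2l muln_gt0.
  have := d_ge2 (ltn0Sn a); have := place_gt a.
  by case: (place d a) => // ?; case: (d a.+1) => [|[]].
have t_inj : {in [pred k | (k < carry_index d n)%N] &, injective (fun k => n - t k)%N}.
  move=> a b /= az bz /eqP; have ta := reset_le az; have tb := reset_le bz.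
  rewrite -(eqn_add2r (t a + t b)) addnA subnK // addnCA subnK // addnC.
  by rewrite eqn_add2r => /eqP; case: (ltngtP a b) => // /t_lt /[swap] ->;
    rewrite ltnn.
have t_gt0 : (0 < t r)%N by apply: leq_ltn_trans (t_lt _ _ r1).
have rn := reset_le rz.
rewrite ifF; last by apply/negbTE; rewrite neq_ltn ltnS leq_subr.
rewrite ifF; last first.
  by apply/negbTE; rewrite neq_ltn ltn_subrL t_gt0 (leq_trans t_gt0 rn).
rewrite big_mkcond [LHS](bigD1_seq r) ?iota_uniq ?mem_index_iota ?r1 ?rz //=.
rewrite eqxx -[RHS]addr0; congr (_ + _); rewrite big_seq_cond big1 // => k.
rewrite mem_index_iota => /andP[/andP[_ kz] /eqP kr]; case: eqP => // rk.
by case: kr; apply: t_inj => //; apply/esym.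
Qed.

Lemma operatorE (R : realType) (p : nat -> R) (w : nat -> complexes R) n :
  operator d p w n =
    \sum_(0 <= m < n.+2) ((transition d p n m)%:C * w m : complexes R).
Proof.
apply/cvg_lim => //; apply: cvg_near_cst; exists n.+2 => // N /= nN.
rewrite seriesEnat /= (big_cat_nat _ (n := n.+2)) //=.
rewrite [X in _ + X]big_nat_cond [X in _ + X]big1 ?addr0 // => m.
rewrite andbT => /andP[nm _].
have mgt k : (m == (n - k)%N) = false.
  by apply: gtn_eqF; apply: leq_ltn_trans (leq_subr _ _) (ltnW nm).
rewrite /transition (gtn_eqF nm) (gtn_eqF (ltnW nm)).
by rewrite big1 ?mul0r // => r; rewrite mgt.
Qed.

End Checks.

(* Main.v *)
(* If [w] is an eigenvector for [lambda], solving the equation at n = 0, 1, ...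
   shows that w(n) = w(0) * prod_j x_j ^ a_j(n), where the a_j(n) are the digits
   of n, lambda = 1 - p_1 + p_1 x_1 and
     x_j ^ d_j = 1 - p_(j+1) + p_(j+1) x_(j+1).
   Since w(k d_1 + 1) = x_1 w(k d_1), a nonzero limit of w forces x_1 = 1, that
   is lambda = 1, and constants are eigenvectors for 1. If w tends to 0, so does
   x_j = w(q_(j-1)) / w(0), and the recursion gives p_j -> 1. Conversely, if
   p_j -> 1, extracting roots backwards in [0, 1) from x_J = 0 yields real
   x_1 < 1; for large J the later terms stay in the disc of radius 1/2, where
   the recursion contracts, so x_j -> 0 and hence w(n) -> 0. *)
Require Import Defs.
From HB Require Import structures.
From mathcomp Require Import all_boot all_order all_algebra complex.
From mathcomp Require Import all_classical all_reals all_analysis.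
From mathcomp Require Import ring lra zify.
Set Implicit Arguments.
Unset Strict Implicit.
Unset Printing Implicit Defensive.
Import Order.TTheory GRing.Theory Num.Theory.
Import numFieldNormedType.Exports.
Local Open Scope classical_set_scope.
Local Open Scope ring_scope.

(** * Digits in the mixed base and the carry in n + 1 *)

Section Digits.
Variable d : nat -> nat.
Hypothesis d0 : d 0%N = 1%N.
Hypothesis d_ge2 : forall j, (1 <= j)%N -> (2 <= d j)%N.

Lemma place_gt0 j : (0 < place d j)%N.
Proof. exact: leq_ltn_trans (place_gt d0 d_ge2 j). Qed.

Lemma dvdn_place i j : (i <= j)%N -> (place d i %| place d j)%N.
Proof.
move=> ij; rewrite /place [X in (_ %| X)%N](big_cat_nat _ (n := i.+1)) //=.
exact: dvdn_mulr.
Qed.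

(** The sum telescopes, as (d_j - 1) q_(j-1) = q_j - q_(j-1); this puts the reset targets of
    [transition] in the form n + 1 - q_r. *)
Lemma reset_sum r :
  (\sum_(1 <= j < r.+1) (d j).-1 * place d j.-1)%N = (place d r).-1.
Proof.
elim: r => [|r IH]; first by rewrite big_geq ?place0.
rewrite big_nat_recr //= IH placeS.
have := d_ge2 (ltn0Sn r); have := place_gt0 r.
case: (place d r) => // q _; case: (d r.+1) => // e _.
by rewrite mulSn addSn [(q * _)%N]mulnC; case: e => *; lia.
Qed.

(** Adding 1 carries through the r lowest digits of n, all maximal, and leaves zeros there. *)
Lemma dvdn_place_succ n r : (r < carry_index d n)%N -> (place d r %| n.+1)%N.
Proof.
have [_ _ full] := carry_index_least d0 d_ge2 n.
elim: r => [|r IH] rz; first by rewrite place0 ?dvd1n.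
have /dvdnP[M nM] := IH (ltnW rz); have := full r.+1 rz.
rewrite /digit succnK (_ : n = n.+1.-1) // nM.
have q0 := place_gt0 r; have dr := d_ge2 (ltn0Sn r).
have M0 : (0 < M)%N by case: (M) nM.
have -> : ((M * place d r).-1 = M.-1 * place d r + (place d r).-1)%N.
  by case: (M) M0 => // k _; rewrite mulSn succnK; lia.
rewrite divnMDl // divn_small ?addn0; last by rewrite prednK.
move=> e; rewrite placeS mulnC dvdn_pmul2r //.
have -> : (M = (M.-1 %/ d r.+1) * d r.+1 + d r.+1)%N.
  by rewrite -{1}(prednK M0) {1}(divn_eq M.-1 (d r.+1)) e -addnS prednK //; lia.
by rewrite dvdn_addr ?dvdnn ?dvdn_mull.
Qed.

Lemma digit_dvdn j n : (1 <= j)%N -> (place d j %| n)%N -> digit d j n = 0%N.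
Proof.
case: j => // j _ /dvdnP[k ->]; rewrite /digit succnK placeS mulnCA mulnC.
by rewrite mulnK ?place_gt0 // modnMl.
Qed.

Section AddPlace.
Variables (r N a : nat).
Hypothesis rN : (place d r %| N)%N.
Hypothesis a_lt : (digit d r.+1 N + a < d r.+1)%N.

Lemma digit_add_place_eq :
  digit d r.+1 (N + a * place d r) = (digit d r.+1 N + a)%N.
Proof.
by rewrite /digit succnK addnC divnMDl ?place_gt0 // addnC -modnDml modn_small.
Qed.

(** [a_lt] excludes a carry, so the quotient by q_(r+1), which fixes all higher digits, is
    unchanged; the lower digits are zero on both sides. *)
Lemma digit_add_place_neq j : (1 <= j)%N -> j != r.+1 ->
  digit d j (N + a * place d r) = digit d j N.
Proof.
move=> j1 /negPf jr; have [jr1|rj|/eqP] := ltngtP j r.+1; last by rewrite jr.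
  have jr' : (place d j %| place d r)%N by apply: dvdn_place.
  rewrite !digit_dvdn // ?(dvdn_trans jr') //.
  by rewrite dvdn_addr ?(dvdn_trans jr') // dvdn_mull.
have /dvdnP[k kE] : (place d r.+1 %| place d j.-1)%N.
  by apply: dvdn_place; case: (j) rj.
rewrite /digit kE placeS [(k * _)%N]mulnC !divnMA; congr (_ %/ _ %% _)%N.
move: rN a_lt => /dvdnP[M ->]; rewrite -mulnDl /digit succnK.
rewrite !mulnK ?place_gt0 // => lt.
rewrite {1}(divn_eq M (d r.+1)) -addnA divnMDl ?(leq_trans _ (d_ge2 _)) //.
by rewrite (divn_small lt) addn0.
Qed.
End AddPlace.

(** * The products of the x_j ^ a_j(n) *)

Variable F : fieldType.

(** Stopping at j = n loses nothing: n < q_n makes all later digits zero. *)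
Definition digit_prod (x : nat -> F) (n : nat) : F :=
  \prod_(1 <= j < n.+1) x j ^+ digit d j n.

Lemma digit_prod_widen x n J : (n < place d J)%N ->
  digit_prod x n = \prod_(1 <= j < J.+1) x j ^+ digit d j n.
Proof.
have widen K L : (K <= L)%N -> (n < place d K)%N ->
    \prod_(1 <= j < L.+1) x j ^+ digit d j n =
    \prod_(1 <= j < K.+1) x j ^+ digit d j n.
  move=> KL nK; rewrite (big_cat_nat _ (n := K.+1)) //=.
  rewrite [X in _ * X]big_nat_cond [X in _ * X]big1 ?mulr1 // => j.
  rewrite andbT => /andP[Kj _]; rewrite digit_eq0 //.
  apply: leq_trans nK (dvdn_leq (place_gt0 _) (dvdn_place _)).
  by case: (j) Kj.
move=> nJ; rewrite /digit_prod; have := place_gt d0 d_ge2 n.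
by case: (leqP n J) => [|/ltnW] Jn nn; rewrite (widen _ _ Jn).
Qed.

Lemma digit_prod_add x r N a :
  (place d r %| N)%N -> (digit d r.+1 N + a < d r.+1)%N ->
  digit_prod x (N + a * place d r) = digit_prod x N * x r.+1 ^+ a.
Proof.
move=> rN a_lt; set n := (N + _)%N.
pose J := (maxn n r.+1); have nJ : (n < place d J)%N.
  by apply: leq_ltn_trans (place_gt d0 d_ge2 _); rewrite leq_maxl.
have NJ : (N < place d J)%N by apply: leq_ltn_trans nJ; rewrite leq_addr.
rewrite !(@digit_prod_widen _ _ J) //.
have rJ : r.+1 \in index_iota 1 J.+1 by rewrite mem_index_iota /= ltnS leq_maxr.
rewrite !(bigD1_seq r.+1 rJ) ?iota_uniq //= digit_add_place_eq // exprD.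
rewrite -!mulrA; congr (_ * _); rewrite mulrC; congr (_ * _).
rewrite big_seq_cond [RHS]big_seq_cond; apply: eq_bigr => j.
by rewrite mem_index_iota => /andP[/andP[j1 _] jr]; rewrite digit_add_place_neq.
Qed.

Lemma digit_prod0 x : digit_prod x 0 = 1.
Proof. by rewrite /digit_prod big_geq. Qed.

Lemma digit_prod_place x r : digit_prod x (place d r) = x r.+1.
Proof.
have := @digit_prod_add x r 0 1; rewrite digit_prod0 mul1r add0n mul1n expr1.
apply; first exact: dvdn0.
by rewrite digit_dvdn ?dvdn0 // add0n d_ge2.
Qed.

(* [n + 1 - place d r] is [n] with its [r] lowest digits, all maximal, reset. *)
Lemma digit_prod_reset x n r : (r.+1 < carry_index d n)%N ->
  digit_prod x (n.+1 - place d r) =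
  digit_prod x (n.+1 - place d r.+1) * x r.+1 ^+ (d r.+1).-1.
Proof.
move=> rz; have qn := dvdn_place_succ rz; have dr := d_ge2 (ltn0Sn r).
have dN : (place d r.+1 %| n.+1 - place d r.+1)%N by rewrite dvdn_sub.
rewrite -digit_prod_add; last 1 first.
- by rewrite digit_dvdn // add0n prednK // (ltn_trans _ dr).
- congr digit_prod; have := dvdn_leq (ltn0Sn n) qn; rewrite placeS.
  by case: (d r.+1) dr => // e _; rewrite succnK mulnS mulnC; lia.
by apply: dvdn_trans dN; apply: dvdn_place.
Qed.

(** Digit r + 1 is the first non-maximal one, so n + 1 arises from n by resetting the r lowest
    digits and raising digit r + 1 by one, with no further carry. *)
Lemma digit_prod_carry x n (r := (carry_index d n).-1) :
  digit_prod x n.+1 = digit_prod x (n.+1 - place d r) * x (carry_index d n).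
Proof.
have [z1 notmax _] := carry_index_least d0 d_ge2 n.
have rz : (r < carry_index d n)%N by rewrite /r prednK.
have zE : carry_index d n = r.+1 by rewrite /r prednK.
have qn := dvdn_place_succ rz; have q0 := place_gt0 r.
have le := dvdn_leq (ltn0Sn n) qn.
rewrite -[in LHS](subnK le) -{2}[place d r]mul1n digit_prod_add.
- by rewrite expr1 zE.
- by rewrite dvdn_sub.
move: notmax; rewrite zE => notmax.
have -> : digit d r.+1 (n.+1 - place d r) = digit d r.+1 n.
  have /dvdnP[M nM] := qn; rewrite /digit succnK.
  have M0 : (0 < M)%N by case: (M) nM.
  rewrite [in RHS](_ : n = M.-1 * place d r + (place d r).-1)%N; last first.
    by case: (M) M0 nM => // k _; rewrite mulSn succnK; lia.
  rewrite divnMDl // [in RHS]divn_small ?prednK // addn0.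
  by rewrite nM -{2}[place d r]mul1n -mulnBl mulnK // subn1.
have := digit_lt d_ge2 n (ltn0Sn r); have := d_ge2 (ltn0Sn r).
by case: (d r.+1) notmax => // e /eqP; rewrite succnK => /negPf; lia.
Qed.

End Digits.

(** * The eigenvalue equation over a field, row by row *)

Section RowSums.
Variables (R : realType) (d : nat -> nat) (p : nat -> R).
Hypothesis d0 : d 0%N = 1%N.
Hypothesis d_ge2 : forall j, (1 <= j)%N -> (2 <= d j)%N.
Hypothesis p_in01 : forall j, (1 <= j)%N -> 0 < p j <= 1.
Variables (F : fieldType) (f : {rmorphism R -> F}).

(** The finite form of [operator], with [f] carrying the real entries into a general field. *)
Definition row_sum (w : nat -> F) (n : nat) : F :=
  \sum_(0 <= m < n.+2) f (transition d p n m) * w m.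

Lemma prod_p_neq0 z : f (\prod_(1 <= j < z.+1) p j) != 0.
Proof.
rewrite fmorph_eq0 big_seq_cond gt_eqF //; apply: prodr_gt0 => j.
by rewrite andbT mem_index_iota => /andP[/p_in01/andP[]].
Qed.

Lemma row_sum_carry (w : nat -> F) n (z := carry_index d n) :
  row_sum w n =
    f (\prod_(1 <= j < z.+1) p j) * w n.+1
    + f (1 - p 1%N) * w n
    + \sum_(1 <= r < z) f ((1 - p r.+1) * \prod_(1 <= j < r.+1) p j)
        * w (n.+1 - place d r)%N.
Proof.
rewrite [LHS]big_nat_recr // [X in X + _ = _]big_nat_recr //=.
rewrite {3}/transition eqxx {2}/transition (ltn_eqF (ltnSn n)) eqxx -/z.
rewrite [LHS]addrC -[RHS]addrA; congr (_ + _).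
rewrite [LHS]addrC; congr (_ + _).
have -> : \sum_(0 <= m < n) (f (transition d p n m) * w m) =
    \sum_(0 <= m < n) \sum_(1 <= r < z) (if (m == n.+1 - place d r)%N then
      f ((1 - p r.+1) * \prod_(1 <= j < r.+1) p j) * w m else 0).
  apply: eq_big_nat => m /= mn.
  rewrite /transition (ltn_eqF mn) (ltn_eqF (leqW mn)).
  rewrite rmorph_sum mulr_suml -/z -big_mkcond /=.
  apply: eq_bigl => r; rewrite (reset_sum d0 d_ge2).
  by have := place_gt0 d0 d_ge2 r; case: (place d r) => // q _; rewrite subSS.
(* Each r selects a single m, in range because q_r >= 2 puts the target below n. *)
rewrite exchange_big /=; apply: eq_big_nat => r /andP[r1 rz].
rewrite -big_mkcond /= big_nat1_eq /= ifT //.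
have := dvdn_leq (ltn0Sn n) (dvdn_place_succ d0 d_ge2 rz).
by have := place_gt d0 d_ge2 r; lia.
Qed.

(* With [q := p] this is the recursion satisfied by the values
   [x j = w (place d j.-1)] of an eigenvector with [w 0 = 1]; [x 0] is junk. *)
Definition digit_rec (q x : nat -> F) :=
  forall j, (1 <= j)%N -> x j ^+ d j = 1 - q j.+1 + q j.+1 * x j.+1.

(** The equation unfolds along the carry: x_(r+1) W(n+1-q_r) equals x_(r+1) ^ d_(r+1)
    W(n+1-q_(r+1)), which the recursion splits into a reset term and the next carry term. At r =
    zeta_n - 1 the remaining factor is W(n+1). *)
Lemma digit_prod_eigen (x : nat -> F) : digit_rec (f \o p) x ->
  forall n, row_sum (digit_prod d x) n =
    (1 - f (p 1%N) + f (p 1%N) * x 1%N) * digit_prod d x n.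
Proof.
move=> xrec n; set W := digit_prod d x; set lambda := 1 - _ + _.
pose c r := f ((1 - p r.+1) * \prod_(1 <= j < r.+1) p j).
have tele r : (r < carry_index d n)%N -> lambda * W n =
    f (\prod_(1 <= j < r.+2) p j) * (x r.+1 * W (n.+1 - place d r)%N)
    + f (1 - p 1%N) * W n
    + \sum_(1 <= k < r.+1) c k * W (n.+1 - place d k)%N.
  elim: r => [|r IH] rz.
    rewrite big_nat1 big_geq // addr0 place0 // subn1 /lambda rmorphB rmorph1.
    by rewrite mulrA -mulrDl addrC.
  have -> := IH (ltnW rz); have := digit_prod_reset d0 d_ge2 x rz.
  rewrite -/W => ->.
  rewrite [in RHS]big_nat_recr //=.
  rewrite [x r.+1 * _]mulrCA -exprS prednK; last first.
    by rewrite (leq_trans _ (d_ge2 _)).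
  rewrite xrec // [X in _ = _ + X]big_nat_recr //= {3}/c.
  rewrite !rmorphM !rmorphB rmorph1 /=.
  by ring.
rewrite row_sum_carry.
have [z1 _ _] := carry_index_least d0 d_ge2 n.
rewrite [RHS](tele (carry_index d n).-1) ?prednK //.
by rewrite /W (digit_prod_carry d0 d_ge2) mulrC [x _ * _]mulrC mulrC.
Qed.

(** Row n determines w(n+1) from earlier values, since its coefficient is a product of nonzero
    p_j. *)
Lemma row_sum_eigen_unique (lambda : F) (v w : nat -> F) :
  (forall n, row_sum v n = lambda * v n) ->
  (forall n, row_sum w n = lambda * w n) ->
  v 0%N = w 0%N -> v =1 w.
Proof.
move=> ve we vw0 n; elim/ltn_ind: n => -[//|n] IH.
have IHn m : (m <= n)%N -> v m = w m by move=> mn; apply: IH.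
have := ve n; rewrite (IHn n) // -we !row_sum_carry (IHn n) //.
rewrite (eq_big_nat _ _ (F2 := fun r => f ((1 - p r.+1) *
  \prod_(1 <= j < r.+1) p j) * w (n.+1 - place d r)%N)) => [|r _].
  by move=> /addIr/addIr/(mulfI (prod_p_neq0 _)).
by rewrite IHn // leq_subLR -add1n leq_add2r place_gt0.
Qed.

Lemma digit_rec_exists (q : nat -> F) x1 :
  (forall j, (1 <= j)%N -> q j != 0) -> exists2 x, x 1%N = x1 & digit_rec q x.
Proof.
(* [it k] stands for x_(k+1); the recursion is solved forwards by dividing by [q]. *)
move=> q0; pose it := fix it k := if k is k'.+1 then
  (it k' ^+ d k'.+1 - 1 + q k'.+2) / q k'.+2 else x1.
exists (fun j => it j.-1) => // -[//|j] _ /=; have := q0 j.+2 isT.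
by move=> qj; field.
Qed.

Lemma p_neq0 j : (1 <= j)%N -> f (p j) != 0.
Proof. by move=> /p_in01/andP[pj _]; rewrite fmorph_eq0 gt_eqF. Qed.

(** The eigenvalue fixes x_1 and the recursion the rest; the digit product is an eigenvector for the
    same eigenvalue, so uniqueness applies after scaling by w(0). *)
Lemma eigenvector_digit_prod (lambda : F) (w : nat -> F) :
  (forall n, row_sum w n = lambda * w n) ->
  exists x, [/\ digit_rec (f \o p) x,
    lambda = 1 - f (p 1%N) + f (p 1%N) * x 1%N
    & forall n, w n = w 0%N * digit_prod d x n].
Proof.
move=> we; have p1 := p_neq0 (leqnn 1).
have [x x1 xrec] := @digit_rec_exists (f \o p)
  ((lambda - 1 + f (p 1%N)) / f (p 1%N)) p_neq0.
have lE : lambda = 1 - f (p 1%N) + f (p 1%N) * x 1%N.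
  by rewrite x1; field.
exists x; split=> //; apply: (row_sum_eigen_unique we); last first.
  by rewrite digit_prod0 mulr1.
move=> n; transitivity (w 0%N * row_sum (digit_prod d x) n).
  rewrite /row_sum mulr_sumr; apply: eq_bigr => m _.
  by rewrite mulrCA.
by rewrite digit_prod_eigen // -lE mulrCA.
Qed.

End RowSums.

(** * Complex sequences and the limits of eigenvectors *)

Section Spectrum.
Local Open Scope complex_scope.
Variables (R : realType) (d : nat -> nat) (p : nat -> R).
Hypothesis d0 : d 0%N = 1%N.
Hypothesis d_ge2 : forall j, (1 <= j)%N -> (2 <= d j)%N.
Hypothesis p_in01 : forall j, (1 <= j)%N -> 0 < p j <= 1.

Notation C := (complexes R).

(* The embedding with codomain [complexes R] instead of [R[i]], so that the
   morphism lemmas produce operations of the structure used in [operator]. *)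
Definition to_complex (a : R) : C := a%:C.

Lemma to_complex_is_additive : zmod_morphism to_complex.
Proof. exact: (rmorphB (real_complex R)). Qed.

Lemma to_complex_is_multiplicative : monoid_morphism to_complex.
Proof.
split; first exact: (rmorph1 (real_complex R)).
exact: (rmorphM (real_complex R)).
Qed.

HB.instance Definition _ :=
  GRing.isZmodMorphism.Build R C to_complex to_complex_is_additive.
HB.instance Definition _ :=
  GRing.isMonoidMorphism.Build R C to_complex to_complex_is_multiplicative.

Lemma norm_to_complex a : `|to_complex a| = to_complex `|a|.
Proof. by rewrite normc_def /= expr0n addr0 sqrtr_sqr. Qed.

Lemma to_complex_lt a b : (to_complex a < to_complex b) = (a < b).
Proof. exact: ltcR. Qed.

Lemma to_complex_le a b : (to_complex a <= to_complex b) = (a <= b).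
Proof. exact: lecR. Qed.

(** Positivity in the order of C forces a zero imaginary part, so radii in complex limits may be
    taken real. *)
Lemma gt0_to_complex (e : C) : 0 < e -> exists2 r, 0 < r & e = to_complex r.
Proof.
case: e => a b; rewrite ltcE /= => /andP[/eqP b0 a0]; exists a => //.
by rewrite b0.
Qed.

Lemma operator_row_sum (w : nat -> C) : operator d p w = row_sum d p to_complex w.
Proof. by apply/funext => n; apply: operatorE. Qed.

Lemma operator_eigenvector (lambda : C) (w : nat -> C) :
  (forall n, operator d p w n = lambda * w n) ->
  exists x, [/\ digit_rec d (to_complex \o p) x,
    lambda = 1 - to_complex (p 1%N) + to_complex (p 1%N) * x 1%N
    & forall n, w n = w 0%N * digit_prod d x n].
Proof.
by rewrite operator_row_sum => /(eigenvector_digit_prod d0 d_ge2 p_in01).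
Qed.

Lemma cvg_nat_ge_id (f : nat -> nat) :
  (forall n, n <= f n)%N -> f @ \oo --> \oo.
Proof.
move=> nf A [N _ NA]; exists N => // n /= Nn.
by apply: NA; apply: leq_trans (nf n).
Qed.

Lemma eigenvalue_cvg (lambda l : C) (w : nat -> C) :
  (forall n, operator d p w n = lambda * w n) ->
  w @ \oo --> l -> l != 0 -> lambda = 1.
Proof.
move=> /operator_eigenvector[x [xrec -> wE]] wl l0.
have d1 : (0 < d 1)%N by rewrite (leq_trans _ (d_ge2 _)).
(* The first digit of k d_1 is 0 and d_1 >= 2, so adding 1 only turns that digit into 1. *)
have wS k : w (k * d 1).+1 = w (k * d 1)%N * x 1%N.
  rewrite (wE _.+1) (wE (k * _)%N) -mulrA; congr (_ * _).
  have := @digit_prod_add d d0 d_ge2 C x 0 (k * d 1%N) 1.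
  rewrite place0 // mul1n !addn1 expr1; apply; first exact: dvd1n.
  by rewrite /digit place0 // divn1 modnMl d_ge2.
have le_k k : (k <= k * d 1)%N by rewrite leq_pmulr.
have cvg0 : (fun k => w (k * d 1)%N) @ \oo --> l.
  by apply: cvg_comp wl; apply: cvg_nat_ge_id.
have cvg1 : (fun k => w (k * d 1)%N * x 1%N) @ \oo --> l.
  under eq_fun do rewrite -wS.
  by apply: cvg_comp wl; apply: cvg_nat_ge_id => k; rewrite (leq_trans (le_k k)).
have /(cvg_unique (@norm_hausdorff _ _) cvg1) :
    (fun k => w (k * d 1)%N * x 1%N) @ \oo --> l * x 1%N.
  exact: cvgM cvg0 (cvg_cst _).
by rewrite -[LHS]mulr1 => /(mulfI l0) <-; ring.
Qed.

(** The constant 1 is the digit product of x_j = 1, which solves the recursion whatever [p] is. *)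
Lemma point_spectrum_c_one : point_spectrum (@space_c R) d p 1.
Proof.
exists (fun=> 1); split; first exact: is_cvg_cst.
  by move=> /(congr1 (@^~ 0%N))/eqP; rewrite oner_eq0.
have W1 : digit_prod d (fun=> 1 : C) = fun=> 1.
  by apply/funext => n; rewrite /digit_prod big1 // => j _; rewrite expr1n.
rewrite operator_row_sum -W1 => n; rewrite (digit_prod_eigen d0 d_ge2).
  by rewrite W1 !mulr1 subrK.
by move=> j _; rewrite expr1n mulr1 subrK.
Qed.

Lemma eigenvalue_c0_cvg_p (lambda : C) :
  point_spectrum (@space_c0 R) d p lambda -> p @ \oo --> (1 : R).
Proof.
move=> [w [w0 wneq0 /operator_eigenvector[x [xrec _ wE]]]].
have w00 : w 0%N != 0.
  by apply/eqP => w00; apply: wneq0; apply/funext => n; rewrite wE w00 mul0r.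
have x0 : (fun j => x j.+1) @ \oo --> (0 : C).
  have -> : (fun j => x j.+1) = (fun j => (w 0%N)^-1 * w (place d j)).
    by apply/funext => j; rewrite (wE (place d j)) digit_prod_place // mulKf.
  rewrite -(mulr0 (w 0%N)^-1); apply: cvgM (cvg_cst _) _.
  by apply: (cvg_comp (place d) w _ w0); apply: cvg_nat_ge_id => j; apply/ltnW/place_gt.
apply/cvgrPdist_lt => e e0.
(* The bound 1 ensures |x_j ^ d_j| <= |x_j|. *)
pose e' := Num.min (e / 2) 1.
have e'0 : 0 < to_complex e'.
  by rewrite -(rmorph0 to_complex) to_complex_lt lt_min ltr01 divr_gt0.
have /cvgr0Pnorm_lt/(_ _ e'0)[N _ xN] := x0.
exists N.+2 => // -[//|[//|j]] /= Nj.
have {}xN k : (N <= k)%N -> `|x k.+1| < to_complex (e / 2) /\ `|x k.+1| <= 1.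
  move=> /xN /= xk; split.
    by rewrite (lt_le_trans xk) // to_complex_le ge_min lexx.
  rewrite -(rmorph1 to_complex) (le_trans (ltW xk)) //.
  by rewrite to_complex_le ge_min lexx orbT.
have [xj xj1] := xN j Nj; have [xj' _] := xN j.+1 (leqW Nj).
rewrite -to_complex_lt -norm_to_complex rmorphB rmorph1.
(* The recursion, solved for 1 - p_(j+2), leaves two terms, one below e/2 and one at most e/2. *)
have -> : 1 - to_complex (p j.+2) =
    x j.+1 ^+ d j.+1 - to_complex (p j.+2) * x j.+2 by rewrite xrec //= addrK.
rewrite [e]splitr rmorphD (le_lt_trans (ler_normB _ _)) // ltr_leD //.
  by rewrite normrX (le_lt_trans _ xj) // ler_iXnr // (leq_trans _ (d_ge2 _)).
rewrite normrM (le_trans _ (ltW xj')) // ler_piMl // norm_to_complex.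
rewrite -(rmorph1 to_complex) to_complex_le.
by have /andP[/ltW/ger0_norm ->] := p_in01 (ltn0Sn j.+1).
Qed.

(** * An eigenvector in c_0 when p tends to 1 *)

Lemma digit_prod_cvg0 (x : nat -> R) :
  (forall j, (1 <= j)%N -> `|x j| <= 1) -> x @ \oo --> (0 : R) ->
  digit_prod d x @ \oo --> (0 : R).
Proof.
move=> x1 /cvgr0Pnorm_lt x0; apply/cvgr0Pnorm_lt => e /x0[K _ xK].
exists (place d K) => // n /= Kn.
have exJ : exists j, (n < place d j)%N by exists n; apply: place_gt.
(* The least J with n < q_J is the index of the leading digit of n. That digit is positive, so its
   factor is at most |x_J| < e, and all other factors are at most 1 in modulus. *)
case: (ex_minnP exJ) => -[|j] nj minj.
  by have := leq_trans (place_gt0 d0 d_ge2 K) Kn; move: nj; rewrite place0; case: (n).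
have jn : (place d j <= n)%N by rewrite leqNgt; apply/negP => /minj; rewrite ltnn.
have Kj : (K <= j)%N.
  rewrite leqNgt; apply/negP => jK; have K0 := place_gt0 d0 d_ge2 K.
  by have := leq_trans nj (dvdn_leq K0 (dvdn_place d jK)); rewrite ltnNge Kn.
have dig : (0 < digit d j.+1 n)%N.
  rewrite /digit succnK modn_small ?divn_gt0 ?place_gt0 //.
  by rewrite ltn_divLR ?place_gt0 // mulnC -placeS.
rewrite (digit_prod_widen d0 d_ge2 _ nj) big_nat_recr //= normrM.
have xj : `|x j.+1| < e by apply: xK; apply: leqW.
rewrite (le_lt_trans _ xj) // -[leRHS]mul1r ler_pM //; last first.
  by rewrite normrX ler_iXnr // x1.
rewrite normr_prod big_seq_cond prodr_ile1 // => i.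
rewrite andbT mem_index_iota => /andP[i1 _].
by rewrite normrX exprn_ge0 // exprn_ile1 // x1.
Qed.

Lemma contraction_cvg0 (u v : nat -> R) (a : R) : 0 <= a < 1 ->
  (forall k, 0 <= u k) -> (forall k, u k.+1 <= a * u k + v k) ->
  v @ \oo --> (0 : R) -> u @ \oo --> (0 : R).
Proof.
move=> /andP[a0 a1] u0 uS v0; apply/cvgr0Pnorm_lt => e e0.
(* Chosen so that a e/2 + (1 - a) e/2 = e/2, which keeps the error e/2 stable under iteration. *)
have e'0 : 0 < (1 - a) * (e / 2) by rewrite mulr_gt0 ?subr_gt0 ?divr_gt0.
have /cvgr0Pnorm_lt/(_ _ e'0)[K _ vK] := v0.
have uK m : u (m + K)%N <= a ^+ m * u K + e / 2.
  elim: m => [|m IH]; first by rewrite expr0 mul1r lerDl divr_ge0 // ltW.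
  rewrite addSn (le_trans (uS _)) // exprS.
  have := vK (m + K)%N (leq_addl _ _); move/(le_lt_trans (ler_norm _)) => vm.
  have := ler_wpM2l a0 IH; lra.
have : (fun m => a ^+ m * u K) @ \oo --> (0 : R).
  rewrite -(mul0r (u K)); apply: cvgM (cvg_cst _).
  by apply: cvg_expr; rewrite ger0_norm.
move=> /cvgr0Pnorm_lt/(_ (e / 2))[|M _ aM]; first by rewrite divr_gt0.
exists (M + K)%N => // n /= Mn; rewrite ger0_norm //.
have Kn : (K <= n)%N by rewrite (leq_trans _ Mn) ?leq_addl.
rewrite -(subnK Kn) (le_lt_trans (uK _)) // [ltRHS]splitr ltrD2r.
have Mn' : (M <= n - K)%N by rewrite leq_subRL // addnC.
exact: le_lt_trans (ler_norm _) (aM _ Mn').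
Qed.

(** Since p_(J+1) > 0 and y < 1, the value 1 - p_(J+1) + p_(J+1) y lies in [0, 1); its d_J-th root
    is the value to prescribe for x_J, and induction goes down to x_1. *)
Lemma digit_rec_backward J y : 0 <= y < 1 ->
  exists2 x, digit_rec d p x & x J.+1 = y /\
    forall j, (1 <= j <= J.+1)%N -> 0 <= x j < 1.
Proof.
have p0 j : (1 <= j)%N -> p j != 0 by move=> /p_in01/andP[pj _]; rewrite gt_eqF.
elim: J y => [|J IH] y y01.
  have [x x1 xrec] := digit_rec_exists d y p0.
  exists x => //; split=> // j /andP[j1 j1'].
  by have -> : j = 1%N by [case: j j1 j1' => [|[]]]; rewrite x1.
have /andP[p_gt0 p_le1] := p_in01 (ltn0Sn J.+1); have /andP[y0 y1] := y01.
set u : R := 1 - p J.+2 + p J.+2 * y.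
have u0 : 0 <= u by rewrite addr_ge0 ?subr_ge0 // mulr_ge0 // ltW.
have u1 : u < 1 by rewrite /u; nra.
have dJ : (0 < d J.+1)%N by rewrite (leq_trans _ (d_ge2 _)).
have [z z01 zu] : exists2 z : R, 0 <= z < 1 & z ^+ d J.+1 = u.
  have zu : (u `^ (d J.+1)%:R^-1) ^+ d J.+1 = u.
    rewrite -powR_mulrn ?powR_ge0 // -powRrM mulVf ?powRr1 //.
    by rewrite pnatr_eq0 -lt0n.
  exists (u `^ (d J.+1)%:R^-1) => //; rewrite powR_ge0 /= ltNge.
  by apply/negP => /(exprn_ege1 (d J.+1)); rewrite zu leNgt u1.
have [x xrec [xJ x01]] := IH z z01.
(* The recursion determines x_(J+2) from x_(J+1), as p_(J+2) is nonzero. *)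
have xJ' : x J.+2 = y.
  apply/(mulfI (p0 J.+2 isT))/(addrI (1 - p J.+2)).
  by rewrite -xrec // xJ zu.
exists x => //; split=> // j /andP[j1]; rewrite leq_eqVlt => /predU1P[->|jJ].
  by rewrite xJ'.
by apply: x01; rewrite j1.
Qed.

(* On the disc of radius 1/2, [z |-> (z ^ d - (1 - q)) / q] is a contraction
   towards [0], up to the error [1 - q], as soon as [q >= 5/6]. *)
Lemma half_disc_step (q z z' : R) (e : nat) :
  (2 <= e)%N -> 5%:R / 6%:R <= q <= 1 ->
  `|z| <= 1 / 2 -> z ^+ e = 1 - q + q * z' ->
  `|z'| <= 1 / 2 /\ `|z'| <= 3%:R / 5%:R * `|z| + 6%:R / 5%:R * (1 - q).
Proof.
move=> e2 /andP[q56 q1] z12 ze.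
have q0 : 0 <= q by apply: le_trans q56; rewrite divr_ge0.
have zz : `|z ^+ e| <= `|z| ^+ 2.
  by rewrite normrX ler_wiXn2l // (le_trans z12) //; lra.
have : q * `|z'| <= `|z| ^+ 2 + (1 - q).
  rewrite -[X in X * _]ger0_norm // -normrM.
  have -> : q * z' = z ^+ e - (1 - q) by rewrite ze; ring.
  rewrite (le_trans (ler_normB _ _)) // [`|1 - q|]ger0_norm ?subr_ge0 //.
  by rewrite lerD2r.
have := normr_ge0 z; have := normr_ge0 z'; rewrite expr2.
move: `|z| `|z'| z12 => s t; nra.
Qed.

Lemma digit_rec_cvg0 : p @ \oo --> (1 : R) ->
  exists x, [/\ digit_rec d p x, x 1%N < 1,
    forall j, (1 <= j)%N -> `|x j| <= 1 & x @ \oo --> (0 : R)].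
Proof.
(* The tolerance 1/6 yields p >= 5/6 from J on, as [half_disc_step] requires. *)
move=> p1; have /cvgrPdist_lt/(_ (1 / 6%:R))[|J _ pJ] := p1.
  by rewrite divr_gt0.
(* The value x_(J+1) = 0 starts the later terms inside the disc of radius 1/2, while the earlier
   ones lie in [0, 1). *)
have [|x xrec [xJ x01]] := @digit_rec_backward J 0; first by rewrite lexx ltr01.
have p56 k : 5%:R / 6%:R <= p (k + J).+2 <= 1.
  have /andP[_ ->] := p_in01 (ltn0Sn (k + J).+1); rewrite andbT.
  have /= := pJ (k + J).+2 (leqW (leqW (leq_addl _ _))).
  by move/(le_lt_trans (ler_norm _)); lra.
have small k : `|x (k + J).+1| <= 1 / 2.
  elim: k => [|k IH]; first by rewrite add0n xJ normr0 divr_ge0.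
  by have [] := half_disc_step (d_ge2 (ltn0Sn _)) (p56 k) IH (xrec _ _).
exists x; split=> //.
- by have /andP[] := x01 1%N isT.
- move=> j j1; have [jJ|Jj] := leqP j J.+1.
    by have /andP[x0 /ltW] := x01 j (introT andP (conj j1 jJ)); rewrite ger0_norm.
  have -> : j = (j - J.+1 + J).+1 by lia.
  by rewrite (le_trans (small _)) //; lra.
rewrite -(cvg_shiftn J.+1); apply/norm_cvg0P.
apply: (@contraction_cvg0 _
  (fun k => 6%:R / 5%:R * (1 - p (k + J).+2)) (3%:R / 5%:R)).
- by apply/andP; split; lra.
- by move=> k; rewrite normr_ge0.
- move=> k; rewrite /= addSn addnS.
  by have [] := half_disc_step (d_ge2 (ltn0Sn _)) (p56 k) (small k) (xrec _ _).
rewrite -(mulr0 (6%:R / 5%:R)); apply: cvgM (cvg_cst _) _.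
rewrite -(subrr 1); apply: cvgB (cvg_cst _) _.
by apply: (cvg_comp (fun k => (k + J).+2) p _ p1); apply: cvg_nat_ge_id => k; lia.
Qed.

Lemma point_spectrum_c0_neq1 : p @ \oo --> (1 : R) ->
  exists2 lambda : C, lambda <> 1 & point_spectrum (@space_c0 R) d p lambda.
Proof.
move=> /digit_rec_cvg0[x [xrec x1 x_le1 x0]].
have WE n : digit_prod d (to_complex \o x) n = to_complex (digit_prod d x n).
  by rewrite /digit_prod rmorph_prod; apply: eq_bigr => j _; rewrite rmorphXn.
exists (1 - to_complex (p 1%N) + to_complex (p 1%N) * to_complex (x 1%N)).
  (* The eigenvalue is real and equals 1 - p_1 (1 - x_1), which is below 1. *)
  rewrite -(rmorph1 to_complex) -rmorphB -rmorphM -rmorphD => -[].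
  have /andP[p1 _] := p_in01 (leqnn 1); nra.
exists (digit_prod d (to_complex \o x)); split.
- apply/(@cvgr0Pnorm_lt _ C) => e /gt0_to_complex[r r0 ->].
  have /cvgr0Pnorm_lt/(_ r r0)[N _ xN] := digit_prod_cvg0 x_le1 x0.
  by exists N => // n /xN; rewrite WE norm_to_complex to_complex_lt.
- move=> /(congr1 (@^~ 0%N))/eqP; rewrite digit_prod0.
  by rewrite oner_eq0.
rewrite operator_row_sum; apply: digit_prod_eigen => // j j1 /=.
by rewrite -rmorphXn xrec // rmorphD rmorphB rmorphM rmorph1.
Qed.

End Spectrum.

Theorem proposition4p10 (R : realType) (d : nat -> nat) (p : nat -> R)
    (d0 : d 0%N = 1%N)
    (d_ge2 : forall j : nat, (1 <= j)%N -> (2 <= d j)%N)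
    (p_in01 : forall j : nat, (1 <= j)%N -> 0 < p j <= 1) :
  point_spectrum (@space_c R) d p =
    point_spectrum (@space_c0 R) d p `|` [set (1 : complexes R)] /\
  (point_spectrum (@space_c R) d p = [set (1 : complexes R)] <->
    ~ (p @ \oo --> (1 : R))).
Proof.
have cE : point_spectrum (@space_c R) d p =
    point_spectrum (@space_c0 R) d p `|` [set (1 : complexes R)].
  apply/seteqP; split=> lambda.
    move=> [w [/cvg_ex[l wl] w0 we]].
    have [l0|l0] := eqVneq l 0; last first.
      by right; apply: (eigenvalue_cvg d0 d_ge2 p_in01 we wl l0).
    by left; exists w; split; [rewrite l0 in wl; exact: wl | exact: w0 | exact: we].
  move=> [[w [wc0 w0 we]]|->]; last exact: point_spectrum_c_one.
  by exists w; split; [apply/cvg_ex; exists 0; exact: wc0 | exact: w0 | exact: we].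
split=> //; split=> [c1 p1|p1].
  have [lambda l1 l0] := point_spectrum_c0_neq1 d0 d_ge2 p_in01 p1.
  by apply: l1; have : (point_spectrum (@space_c R) d p) lambda
    by [rewrite cE; left]; rewrite c1.
(* An eigenvalue on c_0 would force p to tend to 1, so only the point 1 is left. *)
rewrite cE; apply/seteqP; split=> [lambda [|//]|lambda ->]; last by right.
by move=> /(eigenvalue_c0_cvg_p d0 d_ge2 p_in01).
Qed.
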